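(* Let $p\ge 1$ and $p^{-1}+q^{-1}=1$, and let $M=(m_{nk})_{n,k\in\mathbb N}$ be an invertible infinite matrix with complex entries. Then $\ell^q_{(M^{-1})^T}\subseteq(\ell^p_M)^*$. If $M$ is also diagonal, then the reverse inclusion $(\ell^p_M)^*\subseteq\ell^q_{(M^{-1})^T}$ holds, and in particular $\ell^p_M$ is reflexive for $p>1$.
   Context: For an infinite matrix $M=(m_{nk})_{n,k\in\mathbb N}$ with complex entries, $1\le p<\infty$ and $x=(x_k)\in\mathbb C^{\mathbb N}$, set $\|x\|_{M,p}=\Big(\sum_{n=1}^{\infty}\Big(\sum_{k=1}^{\infty}|m_{nk}|\,|x_k|\Big)^p\Big)^{1/p}$, and for $p=\infty$ set $\|x\|_{M,\infty}=\sup_n\sum_{k=1}^\infty|m_{nk}|\,|x_k|$; put $\ell^p_M=\{x\in\mathbb C^{\mathbb N}:\|x\|_{M,p}<\infty\}$, normed by $\|\cdot\|_{M,p}$. $M$ is invertible if there is an infinite matrix $M^{-1}$ with $MM^{-1}=M^{-1}M=I$ (the identity matrix). $(M^{-1})^T$ is the transpose of $M^{-1}$. $(\ell^p_M)^*$ is the space of bounded linear functionals on $\ell^p_M$; a sequence $y=(y_n)\in\mathbb C^{\mathbb N}$ is identified with the functional $x\mapsto\sum_{n=1}^\infty y_n x_n$, and the inclusions are understood with respect to this identification. *)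

(* Defs.v *)
From HB Require Import structures.
From mathcomp Require Import all_boot all_order all_algebra.
From mathcomp Require Import all_classical all_reals all_analysis.
From mathcomp Require Import complex.

Set Implicit Arguments.
Unset Strict Implicit.
Unset Printing Implicit Defensive.

Import Order.TTheory GRing.Theory Num.Theory.
Import numFieldNormedType.Exports.
Import Normc.

Local Open Scope classical_set_scope.
Local Open Scope complex_scope.
Local Open Scope ring_scope.

(* The complex numbers with their usual topology, as a normed space over
   themselves: [^o] is needed because [R[i]] itself carries neither.  Norms of
   a [normedModType R[i]] take (nonnegative real) values in [R[i]], whereas
   [normc] is the modulus with values in [R]. *)
Notation cplx R := (R[i]^o).

Section infinite_matrices.
Context {R : realType}.
Implicit Types (M N : nat -> nat -> cplx R) (x y : nat -> cplx R).

Definition is_mulmx M N (P : nat -> nat -> cplx R) : Prop :=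
  forall n k, series (fun j => M n j * N j k) @ \oo --> P n k.

Definition id_infmx : nat -> nat -> cplx R := fun n k => (n == k)%:R.

(* A two-sided inverse of an infinite matrix need not be unique. *)
Definition is_inverse M N : Prop :=
  is_mulmx M N id_infmx /\ is_mulmx N M id_infmx.

Definition invertible M : Prop := exists N, is_inverse M N.

Definition tr_infmx M : nat -> nat -> cplx R := fun n k => M k n.

Definition is_diagonal M : Prop := forall n k, n != k -> M n k = 0.

Definition absrow M x (n : nat) : \bar R :=
  (\sum_(k <oo) (normc (M n k) * normc (x k))%:E)%E.

(* Only exponents [1 <= p] are meant; [-oo] gets a dummy value. *)
Definition mnorm M (p : \bar R) x : \bar R :=
  match p with
  | r%:E => ((\sum_(n <oo) absrow M x n `^ r) `^ r^-1)%E
  | +oo%E => ereal_sup (range (absrow M x))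
  | -oo%E => 0%E
  end.

Definition lpM M (p : \bar R) : set (nat -> cplx R) :=
  [set x | (mnorm M p x < +oo)%E].

Lemma normcE (z : cplx R) : `|z| = (normc z)%:C. Proof. by []. Qed.

Lemma normc_ge0 (z : cplx R) : 0 <= normc z.
Proof. by case: z => a b /=; exact: sqrtr_ge0. Qed.

Lemma normcD (z w : cplx R) : normc (z + w) <= normc z + normc w.
Proof. exact: le_normcD. Qed.

Lemma absterm_ge0 M x n k : (0 <= (normc (M n k) * normc (x k))%:E)%E.
Proof. by rewrite lee_fin mulr_ge0// normc_ge0. Qed.

Lemma absrow_ge0 M x n : (0 <= absrow M x n)%E.
Proof. by apply: nneseries_ge0 => k _ _; exact: absterm_ge0. Qed.

Lemma absrowD M x y n : (absrow M (x + y)%R n <= absrow M x n + absrow M y n)%E.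
Proof.
rewrite -nneseriesD; try by move=> k _ _; exact: absterm_ge0.
apply: lee_nneseries => k _; first by move=> _; exact: absterm_ge0.
by rewrite -EFinD lee_fin -mulrDr ler_wpM2l ?normc_ge0// normcD.
Qed.

Lemma absrowZ M (a : R[i]) x n :
  absrow M (a *: x) n = ((normc a)%:E * absrow M x n)%E.
Proof.
rewrite -nneseriesZl; last by move=> k _; exact: absterm_ge0.
by apply: eq_eseriesr => k _; rewrite -EFinM normcM mulrCA.
Qed.

Lemma mnorm_ge0 M p x : (0 <= mnorm M p x)%E.
Proof.
case: p => [r| |]//=; first exact: poweR_ge0.
by apply: le_trans (absrow_ge0 M x 0) _; apply: ereal_sup_ubound; exists 0.
Qed.

Lemma absrow_fin M p x n : (1 <= p)%E -> lpM M p x ->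
  absrow M x n \is a fin_num.
Proof.
move=> p1 xp; rewrite ge0_fin_numE ?absrow_ge0//; case: p p1 xp => [r| |]//=.
- rewrite lee_fin => r1; have r0 : 0 < r by exact: lt_le_trans r1.
  rewrite /lpM/= => /lty_poweRy; rewrite invr_eq0 gt_eqF// => /(_ isT) H.
  rewrite ltey; apply/eqP => Hy; move: H; rewrite (nneseries_pinfty _ _ (k := n))//.
  + by move=> ? _; exact: poweR_ge0.
  + by rewrite Hy poweRyr// gt_eqF.
- by move=> _; apply: le_lt_trans; apply: ereal_sup_ubound; exists n.
Qed.

Lemma mnormD M p x y : (1 <= p)%E -> lpM M p x -> lpM M p y ->
  (mnorm M p (x + y)%R <= mnorm M p x + mnorm M p y)%E.
Proof.
move=> p1 xp yp.
have xf n := absrow_fin n p1 xp; have yf n := absrow_fin n p1 yp.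
case: p p1 xp yp => [r| |]//=.
- rewrite lee_fin => r1 _ _; have r0 : 0 < r by exact: lt_le_trans r1.
  pose f n := fine (absrow M x n); pose g n := fine (absrow M y n).
  have f0 n : 0 <= f n by rewrite fine_ge0// absrow_ge0.
  have g0 n : 0 <= g n by rewrite fine_ge0// absrow_ge0.
  have mT (h : nat -> R) : measurable_fun [set: nat] h by [].
  have := @minkowski_EFin _ _ R counting f g r (mT f) (mT g) r1.
  rewrite !Lnorm_counting//= => H.
  apply: (le_trans (le_trans _ H)).
    apply: gt0_ler_poweR; rewrite ?invr_ge0 ?(ltW r0)//.
    + rewrite in_itv/= leey andbT; apply: nneseries_ge0 => *; exact: poweR_ge0.
    + rewrite in_itv/= leey andbT; apply: nneseries_ge0 => *.
      by rewrite lee_fin powR_ge0.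
    + apply: lee_nneseries => n _; first by move=> _; exact: poweR_ge0.
      rewrite -poweR_EFin.
      apply: gt0_ler_poweR; rewrite ?(ltW r0)// ?in_itv/= ?leey ?absrow_ge0//.
        by rewrite andbT lee_fin.
      apply: (le_trans (absrowD M x y n)).
      by rewrite ger0_norm ?addr_ge0// EFinD !fineK.
  by apply: leeD; rewrite le_eqVlt; apply/orP; left; apply/eqP;
    congr (_ `^ _)%E; apply: eq_eseriesr => n _;
    rewrite -poweR_EFin ger0_norm// fineK.
- move=> _ _ _; apply: ge_ereal_sup => _ [n _ <-].
  apply: (le_trans (absrowD M x y n)).
  by apply: leeD; apply: ereal_sup_ubound; exists n.
Qed.

Lemma mnormZ M p (a : R[i]) x : (1 <= p)%E ->
  mnorm M p (a *: x) = ((normc a)%:E * mnorm M p x)%E.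
Proof.
case: p => [r| |]//=.
- rewrite lee_fin => r1; have r0 : 0 < r by exact: lt_le_trans r1.
  under eq_eseriesr do rewrite absrowZ poweRM ?lee_fin ?normc_ge0 ?absrow_ge0//.
  rewrite poweR_EFin nneseriesZl; last by move=> *; exact: poweR_ge0.
  rewrite poweRM ?lee_fin ?powR_ge0//; last first.
    by apply: nneseries_ge0 => *; exact: poweR_ge0.
  by rewrite poweR_EFin -powRrM mulfV ?gt_eqF// powRr1// normc_ge0.
- move=> _; rewrite -ereal_supZl ?normc_ge0//; last first.
    by apply/set0P; exists (absrow M x 0), 0.
  rewrite image_comp; congr (ereal_sup _); apply: eq_imagel => n _.
  exact: absrowZ.
Qed.

Lemma mnorm_eq0 M p x : (1 <= p)%E -> invertible M -> mnorm M p x = 0%E -> x = 0.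
Proof.
move=> p1 [N [_ NM]] x0.
have row0 n : absrow M x n = 0%E.
  case: p p1 x0 => [r| |]//=.
  - rewrite lee_fin => r1; have r0 : 0 < r by exact: lt_le_trans r1.
    move=> /poweR_eq0_eq0 => /(_ _)/eqP.
    rewrite nneseries_ge0 => [/(_ isT)/eqP H|*]; last exact: poweR_ge0.
    have : (absrow M x n `^ r <= 0)%E.
      rewrite -H (nneseriesD1 (n := n))//; last by move=> *; exact: poweR_ge0.
      by rewrite leeDl// nneseries_ge0// => *; exact: poweR_ge0.
    move=> h; apply: (@poweR_eq0_eq0 _ _ r); first exact: absrow_ge0.
    by apply/eqP; rewrite eq_le h poweR_ge0.
  - move=> _ H; apply/eqP; rewrite eq_le absrow_ge0 andbT -H.
    by apply: ereal_sup_ubound; exists n.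
have Mx0 n k : normc (M n k) * normc (x k) = 0.
  have : ((normc (M n k) * normc (x k))%:E <= 0)%E.
    rewrite -(row0 n) /absrow (nneseriesD1 (n := k))//; last first.
      by move=> *; exact: absterm_ge0.
    by rewrite leeDl// nneseries_ge0// => *; exact: absterm_ge0.
  by rewrite lee_fin => h; apply/eqP; rewrite eq_le h mulr_ge0 ?normc_ge0.
apply/funext => k /=; apply: contrapT => /eqP xk0.
have M0 n : M n k = 0.
  apply: eq0_normc; have /eqP := Mx0 n k; rewrite mulf_eq0 => /orP[/eqP//|/eqP].
  by move=> /eq0_normc /eqP; rewrite (negbTE xk0).
have := NM k k; rewrite /id_infmx eqxx.
have -> : series (fun j => N k j * M j k) = cst (0 : cplx R).
  apply/funext => n; rewrite /series/=; apply: big1 => j _.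
  by rewrite M0 mulr0.
move=> /(cvg_unique _ (@cvg_cst _ _ _ _ _)) => /(_ (@norm_hausdorff _ _)) /eqP.
by rewrite eq_sym oner_eq0.
Qed.

End infinite_matrices.

Section lpM_space.
Context {R : realType}.

Definition lpM_pred (M : nat -> nat -> cplx R) (p : \bar R) :
  {pred nat -> cplx R} := mem (lpM M p).

(* The normed space of the sequences of [lpM M p].  The proofs [p1] and [invM]
   are parameters since the norm axioms fail without them: the norm separates
   points only because no column of [M] vanishes. *)
Record lpM_space (M : nat -> nat -> cplx R) (p : \bar R)
    (p1 : (1 <= p)%E) (invM : invertible M) : Type :=
  LpMSpace { lpM_seq :> nat -> cplx R; _ : lpM_seq \in lpM_pred M p }.

Context (M : nat -> nat -> cplx R) (p : \bar R).
Context (p1 : (1 <= p)%E) (invM : invertible M).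
Notation space := (lpM_space p1 invM).

HB.instance Definition _ := [isSub of space for @lpM_seq M p p1 invM].
HB.instance Definition _ := [Choice of space by <:].

Lemma lpM_submod_closed : submod_closed (lpM_pred M p).
Proof.
have Z a x : lpM M p x -> lpM M p (a *: x).
  move=> xp; rewrite /lpM/= mnormZ// lte_mul_pinfty// lee_fin normc_ge0//.
split.
  rewrite inE -(scale0r (0 : nat -> cplx R)) /lpM/= mnormZ// normc0 mul0e.
  exact: ltry.
move=> a x y; rewrite !inE => xp yp.
apply: (le_lt_trans (mnormD p1 (Z a x xp) yp)).
by rewrite lte_add_pinfty//; exact: Z.
Qed.

HB.instance Definition _ := GRing.isSubmodClosed.Build _ _ (lpM_pred M p)
  lpM_submod_closed.
HB.instance Definition _ := [SubChoice_isSubLmodule of space by <:].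

Definition lpM_norm (x : space) : R[i] := (fine (mnorm M p x))%:C.

Lemma mnorm_fineK (x : space) : ((fine (mnorm M p x))%:E = mnorm M p x)%E.
Proof.
rewrite fineK// ge0_fin_numE ?mnorm_ge0//.
by case: x => x /= /set_mem.
Qed.

Lemma ler_lpM_normD (x y : space) :
  lpM_norm (x + y) <= lpM_norm x + lpM_norm y.
Proof.
rewrite -rmorphD/= lecR -lee_fin EFinD !mnorm_fineK.
exact: mnormD p1 (set_mem (valP x)) (set_mem (valP y)).
Qed.

Lemma lpM_normZ (a : R[i]) (x : space) :
  lpM_norm (a *: x) = `|a| * lpM_norm x.
Proof.
rewrite (normcE a) -rmorphM/=; congr (_%:C); apply: EFin_inj.
by rewrite EFinM !mnorm_fineK -mnormZ.
Qed.

Lemma lpM_norm0_eq0 (x : space) : lpM_norm x = 0 -> x = 0.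
Proof.
move=> /(congr1 (@complex.Re R)) /= x0; apply: val_inj; apply: (mnorm_eq0 p1 invM).
by rewrite -mnorm_fineK x0.
Qed.

HB.instance Definition _ := Lmodule_isNormed.Build R[i] space
  ler_lpM_normD lpM_normZ lpM_norm0_eq0.

End lpM_space.

Section dual.
Context {R : realType} (V : normedModType R[i]).

Definition bounded_functional : {pred V -> cplx R} :=
  mem [set f : V -> cplx R | scalar f /\
    exists c : R[i], forall x, `|f x| <= c * `|x|].

Record dual : Type :=
  Dual { dual_fun :> V -> cplx R; _ : dual_fun \in bounded_functional }.

HB.instance Definition _ := [isSub for dual_fun].
HB.instance Definition _ := [Choice of dual by <:].

Lemma bounded_functional_submod_closed : submod_closed bounded_functional.
Proof.
split.
  rewrite inE; split; first by move=> a u v /=; rewrite mulr0 addr0.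
  by exists 0 => x; rewrite normr0 mul0r.
move=> a f g; rewrite !inE => -[fl [cf fb]] [gl [cg gb]].
have E x : (a *: f + g) x = a * f x + g x by [].
split.
  move=> b u v; rewrite !E fl gl !mulrDr !mulrA (mulrC a b) -!addrA.
  by congr (_ + _); rewrite addrCA.
exists (`|a| * cf + cg) => x; rewrite E mulrDl.
apply: (le_trans (ler_normD _ _)); rewrite lerD// normrM -mulrA.
by rewrite ler_wpM2l.
Qed.

HB.instance Definition _ :=
  GRing.isSubmodClosed.Build _ _ bounded_functional
    bounded_functional_submod_closed.
HB.instance Definition _ := [SubChoice_isSubLmodule of dual by <:].

Implicit Types f g : dual.

Lemma dual_scalar f : scalar f.
Proof. by case: f => f /= /set_mem[]. Qed.

Lemma dualZ f (a : R[i]) (x : V) : f (a *: x) = a * f x.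
Proof.
have f0 : f 0 = 0.
  have := dual_scalar f 1 0 0; rewrite scale1r add0r mul1r => /eqP.
  by rewrite -subr_eq0 opprD addrA subrr sub0r oppr_eq0 => /eqP.
by have := dual_scalar f a x 0; rewrite !addr0 f0 addr0.
Qed.

Definition dual_norm_def f : R :=
  sup [set normc (f x) | x in [set x : V | `|x| <= 1]].

Definition dual_norm f : R[i] := (dual_norm_def f)%:C.

Lemma dual_has_sup f :
  has_sup [set normc (f x) | x in [set x : V | `|x| <= 1]].
Proof.
split; first by exists (normc (f 0)), 0 => //=; rewrite normr0 ler01.
have [_ [c fb]] := set_mem (valP f).
exists (normc c) => _ [x /= x1 <-].
rewrite -lecR -!normcE; apply: (le_trans (fb x)).
have [->|x0] := eqVneq x 0; first by rewrite normr0 mulr0.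
have c0 : 0 <= c.
  have : 0 <= c * `|x| by exact: le_trans (fb x).
  by rewrite pmulr_lge0// normr_gt0.
by rewrite ger0_norm// ler_piMr.
Qed.

Lemma ler_dual f (x : V) : `|f x| <= dual_norm f * `|x|.
Proof.
have [->|x0] := eqVneq x 0.
  by rewrite -(scale0r 0) dualZ mul0r normr0 scale0r normr0 mulr0.
have nx0 : 0 < `|x| by rewrite normr_gt0.
rewrite -ler_pdivrMr// -[in leLHS](ger0_norm (ltW nx0)) -normfV -normrM mulrC -dualZ.
rewrite normcE lecR; apply: ub_le_sup; first by have [] := dual_has_sup f.
exists (`|x|^-1 *: x) => //=.
by rewrite normrZ normfV normr_id mulVf ?gt_eqF.
Qed.

Lemma dual_norm_le f (c : R) : (forall x : V, `|x| <= 1 -> normc (f x) <= c) ->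
  dual_norm_def f <= c.
Proof.
move=> H; apply: ge_sup; first by have [] := dual_has_sup f.
by move=> _ [x /= x1 <-]; exact: H.
Qed.

Lemma normc_le_dual f (x : V) : `|x| <= 1 -> normc (f x) <= dual_norm_def f.
Proof. by move=> x1; apply: ub_le_sup; [have [] := dual_has_sup f|exists x]. Qed.

Lemma ler_dual_normD f g : dual_norm (f + g) <= dual_norm f + dual_norm g.
Proof.
rewrite -rmorphD/= lecR; apply: dual_norm_le => x x1.
by apply: (le_trans (normcD _ _)); apply: lerD; exact: normc_le_dual.
Qed.

Lemma dual_normZ (a : R[i]) f : dual_norm (a *: f) = `|a| * dual_norm f.
Proof.
have le b h : dual_norm_def (b *: h) <= normc b * dual_norm_def h.
  apply: dual_norm_le => x x1.
  by rewrite [leLHS](normcM b (h x)) ler_wpM2l ?normc_ge0// normc_le_dual.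
rewrite (normcE a) -rmorphM/=; congr (_%:C); apply/eqP; rewrite eq_le le/=.
have [->|a0] := eqVneq a 0.
  rewrite normc0 mul0r; apply: le_trans (normc_le_dual _ (x := 0) _) => //.
    exact: normc_ge0.
  by rewrite normr0 ler01.
have na0 : 0 < normc a.
  by rewrite lt_neqAle normc_ge0 andbT eq_sym; apply/eqP => /eq0_normc/eqP; exact/negP.
rewrite -ler_pdivlMl// -normcV.
by rewrite -[in leLHS](scalerK a0 f) le.
Qed.

Lemma dual_norm0_eq0 f : dual_norm f = 0 -> f = 0.
Proof.
move=> f0; apply: val_inj; apply/funext => x /=; apply/eqP.
by rewrite -normr_le0 (le_trans (ler_dual f x))// f0 mul0r.
Qed.

HB.instance Definition _ := Lmodule_isNormed.Build R[i] dual
  ler_dual_normD dual_normZ dual_norm0_eq0.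

End dual.

Section reflexivity.
Context {R : realType} (V : normedModType R[i]).

Lemma evaluation_subproof (x : V) :
  ((fun f : dual V => f x) : dual V -> cplx R) \in
    @bounded_functional R (dual V).
Proof.
rewrite inE; split; first by [].
by exists `|x| => f; rewrite mulrC; exact: ler_dual.
Qed.

Definition evaluation (x : V) : dual (dual V) := Dual (evaluation_subproof x).

Definition reflexive_space : Prop := range evaluation = [set: dual (dual V)].

End reflexivity.

Definition represents {R : realType} (M : nat -> nat -> cplx R) (p : \bar R)
    (p1 : (1 <= p)%E) (invM : invertible M) (y : nat -> cplx R)
    (f : dual (lpM_space p1 invM)) : Prop :=
  forall x : lpM_space p1 invM, series (fun n => y n * x n) @ \oo --> f x.

(* Main.v *)
(* For the first inclusion, 1 = |(NM)_nn| <= sum_j |N_nj| |M_jn| gives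
   sum_n |y_n x_n| <= sum_j (sum_n |N_nj| |y_n|) (sum_n |M_jn| |x_n|), which
   Hölder's inequality bounds by the product of the norms of y and x.
   If M is diagonal, l^p_M is a weighted l^p space: finite sequences are dense
   for p < oo, and testing a functional on the extremal vectors of Hölder's
   inequality bounds the norm of its coefficients.  The same test applied to
   an element of the bidual and to the coordinate functionals, together with
   the density of finite sequences in l^q, gives reflexivity. *)
Require Import Defs.
From mathcomp Require Import all_boot all_order all_algebra.
From mathcomp Require Import all_classical all_reals all_analysis.
From mathcomp Require Import complex.

Set Implicit Arguments.
Unset Strict Implicit.
Unset Printing Implicit Defensive.

Import Order.TTheory GRing.Theory Num.Theory.
Import numFieldNormedType.Exports.
Import Normc.

Local Open Scope classical_set_scope.
Local Open Scope ring_scope.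

(** * Absolutely convergent complex series *)

Section complex_limits.
Context {R : realType}.
Implicit Types (z : nat -> cplx R) (l : cplx R).

Lemma normc_lim_le z l (c : R) : z @ \oo --> l ->
  (forall k, normc (z k) <= c) -> normc l <= c.
Proof.
move=> zl zc; apply/ler_addgt0Pr => e e0.
have e0' : 0 < e%:C%C :> R[i] by rewrite ltcR.
have [K _ /(_ K (leqnn K))] := (@cvgrPdist_lt _ (cplx R) _ _ _ _ _).1 zl _ e0'.
rewrite /= Defs.normcE ltcR => /ltW le.
by rewrite addrC -(subrK (z K) l) (le_trans (normcD _ _))// lerD.
Qed.

Lemma cvg_normc_squeeze z l (a : R^nat) : (forall k, normc (l - z k) <= a k) ->
  a @ \oo --> 0 -> z @ \oo --> l.
Proof.
move=> za a0; apply/(@cvgrPdist_lt _ (cplx R)) => e e0.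
(* Positivity in [R[i]] forces a zero imaginary part, so [e] is a positive real. *)
have [eR e0'] : e = (complex.Re e)%:C%C /\ 0 < complex.Re e.
  by move: e0; case: e => u v; rewrite ltcE/= => /andP[/eqP ->].
have /cvgr0_norm_lt/(_ _ e0') := a0.
apply: filterS => k /= ak; rewrite Defs.normcE eR ltcR.
by rewrite (le_lt_trans (za k))// (le_lt_trans (ler_norm _)).
Qed.

Lemma Re_le_normc l : `|complex.Re l| <= normc l.
Proof. by case: l => a b /=; rewrite -sqrtr_sqr ler_wsqrtr// lerDl sqr_ge0. Qed.

Lemma Im_le_normc l : `|complex.Im l| <= normc l.
Proof. by case: l => a b /=; rewrite -sqrtr_sqr ler_wsqrtr// lerDr sqr_ge0. Qed.

Lemma normc_le_ReIm l : normc l <= `|complex.Re l| + `|complex.Im l|.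
Proof.
case: l => a b /=; rewrite -[leRHS]ger0_norm ?addr_ge0// -sqrtr_sqr ler_wsqrtr//.
by rewrite sqrrD !real_normK ?num_real// addrAC lerDl mulrn_wge0// mulr_ge0.
Qed.

(** Real and imaginary parts are dominated by the modulus, so both real series converge by
    comparison; the bound passes from the partial sums to the limit. *)
Lemma abs_cvg_series z (c : R) :
  (\sum_(n <oo) (normc (z n))%:E <= c%:E)%E ->
  exists2 l : cplx R, series z @ \oo --> l & normc l <= c.
Proof.
move=> zc.
have part k : \sum_(0 <= i < k) normc (z i) <= c.
  rewrite -lee_fin -sumEFin; apply: le_trans zc.
  by apply: nneseries_lim_ge => *; rewrite lee_fin normc_ge0.
have real_cvg (f : R^nat) : (forall n, `|f n| <= normc (z n)) ->
    exists l : R, series f @ \oo --> l.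
  move=> fz; apply/cvg_ex; apply: normed_cvg.
  apply: (@series_le_cvg _ _ (fun n => normc (z n))) => //.
  - by move=> n /=.
  - by move=> n; exact: normc_ge0.
  - apply: nondecreasing_is_cvgn.
      by apply: nondecreasing_series => *; exact: normc_ge0.
    by exists c => _ [k _ <-]; exact: part.
have [a za] := real_cvg _ (fun n => Re_le_normc (z n)).
have [b zb] := real_cvg _ (fun n => Im_le_normc (z n)).
have ReIm k : series z k = Complex (series (fun n => complex.Re (z n)) k)
      (series (fun n => complex.Im (z n)) k) :> cplx R.
  rewrite /series/=; elim: k => [|k IH]; first by rewrite !big_geq.
  by rewrite !big_nat_recr//= IH; case: (z k).
have zl : series z @ \oo --> (Complex a b : cplx R).
  apply: (@cvg_normc_squeeze _ _ (fun k => `|a - series (fun n => complex.Re (z n)) k|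
                                    + `|b - series (fun n => complex.Im (z n)) k|)).
    by move=> k; rewrite ReIm; exact: normc_le_ReIm.
  rewrite -[0]addr0 -(@normr0 _ R); apply: cvgD; apply: cvg_norm.
  - by rewrite -(subrr a); apply: cvgB => //; exact: cvg_cst.
  - by rewrite -(subrr b); apply: cvgB => //; exact: cvg_cst.
exists (Complex a b) => //; apply: (normc_lim_le zl) => k.
apply: le_trans (part k); rewrite /series/=.
elim/big_ind2 : _ => [|u u' v v' h h'|//]; first by rewrite normc0.
by rewrite (le_trans (normcD _ _))// lerD.
Qed.

Lemma cvg_series_linear (a : R[i]) (u v : nat -> cplx R) l l' :
  series u @ \oo --> l -> series v @ \oo --> l' ->
  series (fun n => a *: u n + v n) @ \oo --> a *: l + l'.
Proof.
move=> ul vl.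
rewrite [X in X @ _](_ : _ = (a \*: series u) \+ series v).
  by apply: (cvgD (cvgZl_tmp (V := cplx R) (k := a) ul) vl).
by apply/funext => k; rewrite /series/= big_split/= -scaler_sumr.
Qed.

End complex_limits.

(** * Hölder's inequality for row sums and the pairing of sequences *)

Section hoelder.
Context {R : realType}.
Implicit Types (M N : nat -> nat -> cplx R) (x y : nat -> cplx R) (p q : \bar R).

Lemma conjugate_ge1 p q : (1 <= p)%E -> (p^-1 + q^-1 = 1)%E -> (1 <= q)%E.
Proof.
move=> p1 pq; have p0 : (0 < p)%E by rewrite (lt_le_trans _ p1).
have -> : q = hoelder_conjugate p.
  by apply/hoelder_conjugateP; rewrite ?gt_eqF// (lt_trans _ p0).
exact: hoelder_conj_ge1.
Qed.

Lemma mnorm1 M x : mnorm M 1%:E x = (\sum_(n <oo) absrow M x n)%E.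
Proof.
rewrite /= invr1 poweRe1; last by apply: nneseries_ge0 => n _ _; exact: poweR_ge0.
by apply: eq_eseriesr => n _; rewrite poweRe1// absrow_ge0.
Qed.

(** The endpoint pair of exponents 1 and oo; exchanging the factors covers oo and 1. *)
Lemma hoelder_absrow1y M N x y : lpM N +oo%E y ->
  (\sum_(n <oo) absrow M x n * absrow N y n
    <= mnorm M 1%:E x * mnorm N +oo%E y)%E.
Proof.
move=> yp; have s0 := mnorm_ge0 N +oo%E y.
have sfin : mnorm N +oo%E y \is a fin_num by rewrite ge0_fin_numE.
rewrite -(fineK sfin) muleC mnorm1 -nneseriesZl; last by move=> *; exact: absrow_ge0.
apply: lee_nneseries => [n _ _|n _]; first by rewrite mule_ge0// absrow_ge0.
rewrite muleC fineK// lee_wpmul2r ?absrow_ge0//.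
by apply: ereal_sup_ubound; exists n.
Qed.

(** For finite exponents this is Hölder's inequality for the counting measure, applied to the real
    sequences of row sums; an infinite exponent forces its conjugate to be 1. *)
Lemma hoelder_absrow M N p q x y : (1 <= p)%E -> (p^-1 + q^-1 = 1)%E ->
  lpM M p x -> lpM N q y ->
  (\sum_(n <oo) absrow M x n * absrow N y n <= mnorm M p x * mnorm N q y)%E.
Proof.
move=> p1 pq xp yq; have q1 := conjugate_ge1 p1 pq.
have xf n := absrow_fin n p1 xp; have yf n := absrow_fin n q1 yq.
case: p => [r| |]// in p1 pq xp *; last first.
  have q1E : q = 1%:E.
    by move: pq; rewrite invey add0e => /eqP; rewrite inve_eq1 => /eqP.
  rewrite q1E muleC; under eq_eseriesr do rewrite muleC.
  exact: hoelder_absrow1y.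
case: q => [s| |]// in q1 pq yq *; last first.
  move: pq; rewrite invey adde0 => /eqP; rewrite inve_eq1 => /eqP ->.
  exact: hoelder_absrow1y.
move: p1 q1; rewrite !lee_fin => r1 s1.
have r0 : 0 < r by exact: lt_le_trans r1.
have s0 : 0 < s by exact: lt_le_trans s1.
move: pq; rewrite !inver !gt_eqF// => -[rs].
pose f n := fine (absrow M x n); pose g n := fine (absrow N y n).
have f0 n : 0 <= f n by rewrite fine_ge0// absrow_ge0.
have g0 n : 0 <= g n by rewrite fine_ge0// absrow_ge0.
have mT (h : nat -> R) : measurable_fun [set: nat] h by [].
have := @hoelder _ _ R counting f g r s (mT f) (mT g) r0 s0 rs.
rewrite !Lnorm_counting//= invr1 poweRe1; last by apply: nneseries_ge0.
congr (_ <= _)%E.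
  apply: eq_eseriesr => n _.
  by rewrite powRr1// ger0_norm ?mulr_ge0// EFinM !fineK.
by congr ((_ `^ _) * (_ `^ _))%E; apply: eq_eseriesr => n _;
  rewrite -poweR_EFin ger0_norm// fineK.
Qed.

Lemma lpM_pairing M N p q x y : (1 <= p)%E -> (p^-1 + q^-1 = 1)%E ->
  is_mulmx N M id_infmx -> lpM M p x -> lpM (tr_infmx N) q y ->
  (\sum_(n <oo) (normc (y n) * normc (x n))%:E
    <= mnorm M p x * mnorm (tr_infmx N) q y)%E.
Proof.
move=> p1 pq NM xp yq; apply: le_trans (hoelder_absrow p1 pq xp yq).
(* Matrix products only involve convergence of partial sums. If [S] is infinite the bound is
   trivial; otherwise the series converges absolutely to a limit of modulus at most [S], and that
   limit is the diagonal entry 1. *)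
have NM1 n : (1 <= \sum_(j <oo) (normc (N n j) * normc (M j n))%:E)%E.
  set S := (X in (_ <= X)%E).
  have [->|Sfin] := eqVneq S +oo%E; first exact: leey.
  have S0 : (0 <= S)%E by apply: nneseries_ge0 => *; rewrite lee_fin mulr_ge0 ?normc_ge0.
  have SE : (fine S)%:E = S by rewrite fineK// ge0_fin_numE ?ltey.
  rewrite -SE lee_fin.
  have [l] : exists2 l : cplx R,
      series (fun j => N n j * M j n : cplx R) @ \oo --> l & normc l <= fine S.
    by apply: abs_cvg_series; rewrite SE; under eq_eseriesr do rewrite normcM.
  move=> /(cvg_unique (@norm_hausdorff _ _) (NM n n)) <-.
  by rewrite /id_infmx eqxx normc1.
pose a n j := ((normc (M j n) * normc (x n)) * (normc (N n j) * normc (y n)))%:E.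
have a0 n j : (0 <= a n j)%E by rewrite lee_fin !mulr_ge0 ?normc_ge0.
apply: (@le_trans _ _ (\sum_(n <oo) \sum_(j <oo) a n j)%E).
  apply: lee_nneseries => n _; first by move=> _; rewrite lee_fin mulr_ge0 ?normc_ge0.
  have aE j : a n j = ((normc (y n) * normc (x n))%:E *
      (normc (N n j) * normc (M j n))%:E)%E.
    by rewrite /a -EFinM mulrACA mulrC (mulrC (normc (x n))) (mulrC (normc (M j n))).
  under eq_eseriesr do rewrite aE.
  rewrite nneseriesZl; last by move=> *; rewrite lee_fin mulr_ge0 ?normc_ge0.
  rewrite -[leLHS]mule1 lee_wpmul2l// lee_fin mulr_ge0 ?normc_ge0//.
(* Once the nonnegative sums are exchanged, [j] is fixed: the single term |N_nj| |y_n| is at most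
   [absrow (tr_infmx N) y j], and the remaining factors |M_jn| |x_n| sum to [absrow M x j]. *)
rewrite nneseries_interchange//; apply: lee_nneseries => [j _ _|j _].
  by apply: nneseries_ge0.
have yf := absrow_fin j (conjugate_ge1 p1 pq) yq.
rewrite -{1}(fineK yf) muleC /absrow -nneseriesZl; last by move=> *; exact: absterm_ge0.
apply: lee_nneseries => [n _ _//|n _].
rewrite /a mulrC EFinM lee_wpmul2r ?absterm_ge0// fineK//.
rewrite (nneseriesD1 (n := n))//; last by move=> *; exact: absterm_ge0.
by rewrite leeDl// nneseries_ge0// => *; exact: absterm_ge0.
Qed.

Lemma lpMB M p x y : (1 <= p)%E -> lpM M p x -> lpM M p y -> lpM M p (x - y).
Proof.
move=> p1 xp yp; have -> : x - y = -1 *: y + x by rewrite scaleN1r addrC.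
exact: set_mem ((lpM_submod_closed M p1).2 _ _ _ (mem_set yp) (mem_set xp)).
Qed.

End hoelder.

(** * Functionals given by sequences *)

Section representation.
Context {R : realType} (p q : \bar R) (p1 : (1 <= p)%E).
Context (pq : (p^-1 + q^-1 = 1)%E) (M N : nat -> nat -> cplx R).
Context (invM : invertible M) (NM : is_mulmx N M id_infmx).
Local Notation V := (lpM_space p1 invM).
Implicit Types (x : V) (y : nat -> cplx R) (f g : dual V).

Lemma lpM_mem x : lpM M p x.
Proof. exact: (set_mem (valP x)). Qed.

Lemma lpM_normE x : `|x| = (fine (mnorm M p x))%:C%C.
Proof. by []. Qed.

Lemma lpM_seq_linear (a : R[i]) x x' n : (a *: x + x' : V) n = a * x n + x' n.
Proof. by []. Qed.

Lemma lpM_series_cvg x y : lpM (tr_infmx N) q y ->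
  exists2 l : cplx R, series (fun n => y n * x n) @ \oo --> l &
    normc l <= fine (mnorm (tr_infmx N) q y) * fine (mnorm M p x).
Proof.
move=> yq; apply: abs_cvg_series; under eq_eseriesr do rewrite normcM.
apply: le_trans (lpM_pairing p1 pq NM (lpM_mem x) yq) _.
have yfin : mnorm (tr_infmx N) q y \is a fin_num by rewrite ge0_fin_numE ?mnorm_ge0.
by rewrite EFinM muleC (mnorm_fineK x) (fineK yfin).
Qed.

Lemma represents_bound y f x : represents y f -> lpM (tr_infmx N) q y ->
  `|f x| <= (fine (mnorm (tr_infmx N) q y))%:C%C * `|x|.
Proof.
move=> yf yq; have [l yl lc] := lpM_series_cvg x yq.
have -> : f x = l by exact: (cvg_unique (@norm_hausdorff _ _) (yf x) yl).
by rewrite lpM_normE Defs.normcE -rmorphM/= lecR.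
Qed.

(** This transfers estimates on coefficient sequences to the dual norm, as elements of the bidual
    require. *)
Lemma represents_norm y f : represents y f -> lpM (tr_infmx N) q y ->
  `|f| <= (fine (mnorm (tr_infmx N) q y))%:C%C.
Proof.
move=> yf yq; rewrite [leLHS](_ : _ = (dual_norm_def f)%:C%C)// lecR.
apply: dual_norm_le => x x1.
rewrite -lecR -Defs.normcE (le_trans (represents_bound x yf yq))//.
by rewrite -[leRHS]mulr1 ler_wpM2l// ler0c fine_ge0// mnorm_ge0.
Qed.

Lemma represents_linear (a : R[i]) y y' f g :
  represents y f -> represents y' g -> represents (a *: y + y') (a *: f + g).
Proof.
move=> yf yg x.
rewrite [X in series X](_ : _ = (fun n => a *: (y n * x n) + y' n * x n)).
  exact: cvg_series_linear (yf x) (yg x).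
by apply/funext => n; rewrite mulrDl scalerAl.
Qed.

Lemma representsB y y' f g :
  represents y f -> represents y' g -> represents (y - y') (f - g).
Proof.
move=> yf yg.
have -> : y - y' = -1 *: y' + y by rewrite scaleN1r addrC.
have -> : f - g = -1 *: g + f by rewrite scaleN1r addrC.
exact: represents_linear.
Qed.

Lemma represents_exists y : lpM (tr_infmx N) q y ->
  exists f : dual V, represents y f.
Proof.
move=> yq.
(* The values of the functional are chosen as limits, so linearity follows from uniqueness of
   limits. *)
have /choice[F FP] : forall x : V, exists l : cplx R,
    series (fun n => y n * x n) @ \oo --> l /\
    normc l <= fine (mnorm (tr_infmx N) q y) * fine (mnorm M p x).
  by move=> x; have [l] := lpM_series_cvg x yq; exists l.
have Fb : F \in @bounded_functional R V.
  rewrite inE; split.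
    move=> a x x'; apply: (cvg_unique (@norm_hausdorff _ _) (FP _).1).
    rewrite [X in series X](_ : _ = (fun n => a *: (y n * x n) + y n * x' n)).
      exact: cvg_series_linear (FP x).1 (FP x').1.
    by apply/funext => n; rewrite lpM_seq_linear mulrDr scalerAr.
  exists (fine (mnorm (tr_infmx N) q y))%:C%C => x.
  by rewrite lpM_normE Defs.normcE -rmorphM/= lecR (FP x).2.
by exists (Dual Fb) => x; exact: (FP x).1.
Qed.

End representation.

(** * Diagonal matrices and truncated sequences *)

Section diagonal.
Context {R : realType}.
Implicit Types (M N : nat -> nat -> cplx R) (x c : nat -> cplx R) (r : R).

Lemma absrow_diag M x n : is_diagonal M ->
  absrow M x n = (normc (M n n) * normc (x n))%:E.
Proof.
move=> Md; rewrite /absrow (nneseriesD1 (n := n))//; last by move=> *; exact: absterm_ge0.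
rewrite eseries0 ?adde0// => k _ /= kn.
by rewrite Md 1?eq_sym// normc0 mul0r.
Qed.

Lemma mulmx_diag M N (P : nat -> nat -> cplx R) n k :
  is_diagonal M -> is_mulmx M N P -> M n n * N n k = P n k.
Proof.
move=> Md /(_ n k); apply: (cvg_unique (@norm_hausdorff _ _)).
(* Only index [n] contributes to row [n], so the partial sums are constant from [n.+1] terms on. *)
apply: cvg_near_cst; exists n.+1 => //= m /= nm.
rewrite /series/= (bigD1_seq n) ?iota_uniq ?mem_index_iota//=.
by rewrite big1 ?addr0// => j jn; rewrite Md 1?eq_sym// mul0r.
Qed.

Lemma inverse_diag M N n : is_diagonal M -> is_inverse M N -> M n n * N n n = 1.
Proof. by move=> Md [MN _]; rewrite (mulmx_diag _ _ Md MN) /id_infmx eqxx. Qed.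

Lemma is_diagonal_inverse M N :
  is_diagonal M -> is_inverse M N -> is_diagonal N.
Proof.
move=> Md MN n k nk; have M0 : M n n != 0.
  apply: contra_eq_neq (inverse_diag n Md MN) => ->.
  by rewrite mul0r eq_sym oner_neq0.
apply: (mulfI M0); rewrite mulr0 (mulmx_diag _ _ Md MN.1) /id_infmx.
by rewrite (negbTE nk).
Qed.

Lemma is_diagonal_tr M : is_diagonal M -> is_diagonal (tr_infmx M).
Proof. by move=> Md n k nk; rewrite /tr_infmx Md// eq_sym. Qed.

Definition trunc (k : nat) x : nat -> cplx R := fun n => if (n < k)%N then x n else 0.

Lemma mnorm_trunc M r c k : is_diagonal M -> 0 < r ->
  mnorm M r%:E (trunc k c) =
  ((\sum_(0 <= n < k) (normc (M n n) * normc (c n)) `^ r) `^ r^-1)%:E.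
Proof.
move=> Md r0; rewrite -poweR_EFin [LHS]/=; congr (_ `^ _)%E.
rewrite (@nneseries_split _ _ 0 k); last by move=> *; exact: poweR_ge0.
rewrite add0n eseries0 ?adde0.
  rewrite -sumEFin; apply: eq_big_nat => n /andP[_ nk].
  by rewrite absrow_diag// poweR_EFin /trunc nk.
move=> n kn _; rewrite absrow_diag// /trunc ifF ?normc0 ?mulr0; last by rewrite ltnNge kn.
by rewrite poweR0r// gt_eqF.
Qed.

Lemma lpM_trunc M r c k : is_diagonal M -> 0 < r -> lpM M r%:E (trunc k c).
Proof. by move=> Md r0; rewrite /lpM/= -/(mnorm M r%:E _) mnorm_trunc// ltry. Qed.

(** Density of finite sequences: the [r]-th power of the norm of the remainder is the tail of a
    convergent series. *)
Lemma mnorm_sub_trunc_cvg0 M r x : is_diagonal M -> 0 < r -> lpM M r%:E x ->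
  fine (mnorm M r%:E (x - trunc k x)) @[k --> \oo] --> (0 : R).
Proof.
move=> Md r0 xr; have rV0 : 0 < r^-1 by rewrite invr_gt0.
pose s k := (\sum_(k <= n <oo) absrow M x n `^ r)%E.
have sE k : mnorm M r%:E (x - trunc k x) = (s k `^ r^-1)%E.
  rewrite [LHS]/=; congr (_ `^ _)%E; rewrite /s [RHS]ereal_series [RHS]eseries_mkcond.
  apply: eq_eseriesr => n _; rewrite !absrow_diag//.
  rewrite [(x - trunc k x) n](_ : _ = x n - trunc k x n)// /trunc.
  case: leqP => _; first by rewrite subr0.
  by rewrite subrr normc0 mulr0 poweR0r// gt_eqF.
have s_cvg : fine (s k) @[k --> \oo] --> (0 : R).
  apply: fine_cvg; apply: nneseries_tail_cvg => [|n _]; last exact: poweR_ge0.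
  by apply: lty_poweRy xr; rewrite gt_eqF.
apply/cvgr0Pnorm_lt => e e0.
(* The tail is compared with the [r]-th power of [e] because the norm is its [r]-th root. *)
have er0 : 0 < e `^ r by exact: powR_gt0.
have /cvgr0_norm_lt/(_ _ er0) := s_cvg; apply: filterS => k.
have s0 : 0 <= fine (s k) by apply/fine_ge0/nneseries_ge0 => *; exact: poweR_ge0.
rewrite sE fine_poweR !ger0_norm ?powR_ge0// => sk.
rewrite -[ltRHS](powRr1 (ltW e0)) -(mulfV (lt0r_neq0 r0)) powRrM.
by apply: gt0_ltr_powR; rewrite // nnegrE// ltW.
Qed.

End diagonal.

(** * Bounded functionals along expansions of vectors *)

Section dual_coefficients.
Context {R : realType} (V : normedModType R[i]).
Implicit Types (u : nat -> V) (g : dual V) (v : V) (c : nat -> cplx R).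

Lemma dual_series u g c k :
  g (\sum_(0 <= n < k) c n *: u n) = \sum_(0 <= n < k) c n * g (u n).
Proof.
elim: k => [|k IH]; first by rewrite !big_geq// -(scale0r 0) dualZ mul0r.
by rewrite !big_nat_recr//= [X in g X]addrC dual_scalar IH addrC.
Qed.

Lemma normc_dual_le g v (a : R) : `|v| <= a%:C%C -> normc (g v) <= dual_norm_def g * a.
Proof.
move=> va; rewrite -lecR -Defs.normcE (le_trans (ler_dual g v))//.
rewrite rmorphM/= ler_wpM2l// /dual_norm ler0c.
by apply: le_trans (normc_le_dual g (x := 0) _); rewrite ?normc_ge0// normr0 ler01.
Qed.

(** The error after [k] terms is at most the norm of [g] times [a k]. [V] will be l^p_M with its
    unit vectors, then the dual with its coordinate functionals. *)
Lemma dual_series_cvg u g c v (a : R^nat) :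
  (forall k, `|v - \sum_(0 <= n < k) c n *: u n| <= (a k)%:C%C) ->
  a @ \oo --> 0 -> series (fun n => c n * g (u n)) @ \oo --> g v.
Proof.
move=> va a0; apply: (@cvg_normc_squeeze _ _ _ (fun k => dual_norm_def g * a k)).
  move=> k; have := normc_dual_le g (va k); congr (normc _ <= _).
  rewrite /series/= -dual_series addrC -scaleN1r.
  by rewrite [LHS]dual_scalar mulN1r addrC.
by rewrite -(mulr0 (dual_norm_def g)); apply: cvgMl_tmp.
Qed.

End dual_coefficients.

(** * The converse of Hölder's inequality *)

Section dual_coefficients_lpM.
Context {R : realType} (V : normedModType R[i]).
Implicit Types (u : nat -> V) (g : dual V) (c : nat -> cplx R).

Lemma normc_real (a : R) : normc (a%:C%C) = `|a|.
Proof. by rewrite /= expr0n addr0 sqrtr_sqr. Qed.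

(** Testing [g] on finite combinations of the [u n] bounds the norm of its coefficients. [V] and [u]
    are general so that one argument serves both functionals on l^p_M and elements of the bidual. *)
Lemma dual_coef_lpM (A B : nat -> nat -> cplx R) (r : R) (q : \bar R) u g :
  is_diagonal A -> is_diagonal B -> (forall n, A n n * B n n = 1) ->
  1 <= r -> (r%:E^-1 + q^-1 = 1)%E ->
  (forall c k, `|\sum_(0 <= n < k) c n *: u n| <=
               (fine (mnorm A r%:E (trunc k c)))%:C%C) ->
  lpM B q (fun n => g (u n)).
Proof.
move=> Ad Bd AB r1 rq bnd; have r0 : 0 < r by exact: lt_le_trans r1.
have q1 : (1 <= q)%E by apply: (@conjugate_ge1 _ r%:E).
pose C := dual_norm_def g.
have gbnd c k : normc (\sum_(0 <= n < k) c n * g (u n)) <=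
    C * (\sum_(0 <= n < k) (normc (A n n) * normc (c n)) `^ r) `^ r^-1.
  by rewrite -dual_series; have := normc_dual_le g (bnd c k); rewrite mnorm_trunc.
have C0 : 0 <= C.
  by apply: le_trans (normc_le_dual g (x := 0) _); rewrite ?normc_ge0// normr0 ler01.
have nAB n : normc (A n n) * normc (B n n) = 1 by rewrite -normcM AB normc1.
case: q => [s| |]// in rq q1 *; last first.
  have rE : r = 1.
    by move: rq; rewrite invey adde0 => /eqP; rewrite inve_eq1 => /eqP [].
  apply: (@le_lt_trans _ _ C%:E); last exact: ltry.
  apply: ge_ereal_sup => _ [n _ <-]; rewrite absrow_diag// lee_fin.
  (* For [r = 1] the [n]-th unit vector is the test; truncation at [n.+1] keeps its entry. *)
  have := gbnd (fun m => (m == n)%:R) n.+1.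
  rewrite !big_nat_recr//= eqxx mul1r normc1 mulr1 !big1_seq ?add0r; last 2 first.
  - move=> m /=; rewrite mem_index_iota => /andP[_ mn].
    by rewrite lt_eqF// normc0 mulr0 powR0// gt_eqF.
  - move=> m /=; rewrite mem_index_iota => /andP[_ mn].
    by rewrite lt_eqF// mul0r.
  rewrite rE invr1 !powRr1 ?normc_ge0// => gn.
  by rewrite -[C]mulr1 -(nAB n) mulrA mulrC ler_wpM2r// normc_ge0.
move: q1; rewrite lee_fin => s1; have s0 : 0 < s by exact: lt_le_trans s1.
move: rq; rewrite !inver !gt_eqF// => -[rs].
(* Conjugacy of [r] and [s] in the form that turns the [r]-th power of b^(s-1), the weighted size of
   the test vector, into b^s. *)
have sr : (s - 1) * r = s.
  have -> : s - 1 = s * r^-1.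
    by rewrite -[in LHS](mulfV (lt0r_neq0 s0)) -{1}[s]mulr1 -mulrBr -rs addrK.
  by rewrite -mulrA mulVf ?mulr1// gt_eqF.
pose b n := normc (B n n) * normc (g (u n)).
have b0 n : 0 <= b n by rewrite mulr_ge0 ?normc_ge0.
pose S k := \sum_(0 <= n < k) b n `^ s.
have S0 k : 0 <= S k by apply: sumr_ge0 => *; exact: powR_ge0.
have SC k : S k <= C `^ s.
  (* The functional is tested against the vector on which Hölder's inequality
     is an equality. *)
  have [c cg Ac] : exists2 c : nat -> cplx R,
      forall n, c n * g (u n) = (b n `^ s)%:C%C &
      forall n, normc (A n n) * normc (c n) <= b n `^ (s - 1).
    (* The quotient of [normc (g (u n))] by [g (u n)] supplies the phase; where [g (u n)] vanishes,
       division by zero gives 0, in agreement with [b n = 0]. *)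
    exists (fun n => (normc (B n n) * b n `^ (s - 1) * normc (g (u n)))%:C%C
        / g (u n)) => n.
      have [gn0|gn0] := eqVneq (g (u n)) 0.
        by rewrite gn0 mulr0 /b gn0 normc0 mulr0 powR0// gt_eqF.
      by rewrite divfK// mulrAC -/(b n) mulr_powRB1.
    rewrite normcM normcV normc_real ger0_norm ?mulr_ge0 ?powR_ge0 ?normc_ge0//.
    rewrite !mulrA nAB mul1r.
    have [->|gn0] := eqVneq (normc (g (u n))) 0; first by rewrite mulr0 mul0r powR_ge0.
    by rewrite mulfK.
  (* For this [c] the left side of [gbnd] is [S k], and the sum on its right is at most [S k]. *)
  have SCS : S k <= C * S k `^ r^-1.
    have sumE : \sum_(0 <= n < k) c n * g (u n) = (S k)%:C%C.
      by rewrite rmorph_sum; apply: eq_bigr => n _; exact: cg.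
    have := gbnd c k; rewrite sumE (normc_real (S k)) (ger0_norm (S0 k)) => h.
    apply: (le_trans h).
    apply: ler_wpM2l C0 _ _ _.
    apply: ge0_ler_powR; rewrite ?nnegrE ?invr_ge0 ?(ltW r0) ?S0//.
      by apply: sumr_ge0 => *; exact: powR_ge0.
    apply: ler_sum => n _; rewrite -[in leRHS]sr powRrM.
    by rewrite ge0_ler_powR ?nnegrE ?(ltW r0) ?powR_ge0 ?mulr_ge0 ?normc_ge0.
  have [->|Sn0] := eqVneq (S k) 0; first exact: powR_ge0.
  have Sgt0 : 0 < S k by rewrite lt0r Sn0 S0.
  (* Division by S^(1/r) leaves S^(1/s), since 1 - 1/r = 1/s. *)
  have le : S k `^ s^-1 <= C.
    rewrite -(ler_pM2r (powR_gt0 r^-1 Sgt0)) -powRD ?Sn0 ?implybT//.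
    by rewrite addrC rs powRr1.
  rewrite -[leLHS](powRr1 (S0 k)) -(mulVf (lt0r_neq0 s0)) powRrM.
  by rewrite ge0_ler_powR ?nnegrE ?(ltW s0) ?powR_ge0.
rewrite /lpM/=; apply: poweR_lty; apply: (@le_lt_trans _ _ (C `^ s)%:E); last exact: ltry.
apply: lime_le; first by apply: is_cvg_nneseries => *; exact: poweR_ge0.
apply: nearW => k; under eq_bigr do rewrite absrow_diag// poweR_EFin.
by rewrite sumEFin lee_fin; exact: SC.
Qed.

End dual_coefficients_lpM.

(** * Dual and bidual for a diagonal matrix *)

Section diagonal_dual.
Context {R : realType}.

Definition delta_seq (n : nat) : nat -> cplx R := fun m => (m == n)%:R.

Lemma sum_delta_seq (x : nat -> cplx R) k :
  \sum_(0 <= n < k) x n *: delta_seq n = trunc k x.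
Proof.
apply/funext => m; rewrite fct_sumE /trunc.
have E n : (x n *: delta_seq n) m = x n * (m == n)%:R by [].
under eq_bigr do rewrite E.
case: ltnP => mk; last first.
  rewrite big1_seq// => n /=; rewrite mem_index_iota => nk.
  by rewrite gt_eqF ?mulr0//; exact: leq_trans mk.
rewrite (bigD1_seq m) ?iota_uniq ?mem_index_iota//= eqxx mulr1 big1 ?addr0//.
by move=> n nm; rewrite eq_sym (negbTE nm) mulr0.
Qed.

Lemma trunc_delta_seq n : trunc n.+1 (delta_seq n) = delta_seq n.
Proof.
apply/funext => m; rewrite /trunc /delta_seq; case: ltnP => // nm.
by rewrite gt_eqF.
Qed.

Lemma lpM_delta_seq (M : nat -> nat -> cplx R) r n :
  is_diagonal M -> 0 < r -> lpM M r%:E (delta_seq n).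
Proof. by rewrite -trunc_delta_seq; exact: lpM_trunc. Qed.

Context (r : R) (M : nat -> nat -> cplx R) (p1 : (1 <= r%:E)%E).
Context (invM : invertible M) (Md : is_diagonal M).
Local Notation V := (lpM_space p1 invM).

Let r1 : 1 <= r. Proof. by rewrite -lee_fin. Qed.
Let r0 : 0 < r. Proof. exact: lt_le_trans r1. Qed.

Definition delta_vec n : V :=
  LpMSpace p1 invM (mem_set (lpM_delta_seq n Md r0)).

Lemma sum_delta_vec (c : nat -> cplx R) k :
  lpM_seq (\sum_(0 <= n < k) c n *: delta_vec n) = trunc k c.
Proof.
rewrite -sum_delta_seq; elim: k => [|k IH]; first by rewrite !big_geq.
by rewrite !big_nat_recr//= -IH.
Qed.

Lemma norm_sum_delta_vec (c : nat -> cplx R) k :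
  `|\sum_(0 <= n < k) c n *: delta_vec n| =
  (fine (mnorm M r%:E (trunc k c)))%:C%C.
Proof. by rewrite lpM_normE sum_delta_vec. Qed.

Lemma norm_sub_sum_delta_vec (x : V) k :
  `|x - \sum_(0 <= n < k) x n *: delta_vec n| =
  (fine (mnorm M r%:E (lpM_seq x - trunc k x)))%:C%C.
Proof. by rewrite lpM_normE -sum_delta_vec. Qed.

(** The expansion of [x] in unit vectors converges in norm, and [f] is bounded. *)
Lemma dual_represented (f : dual V) : represents (fun n => f (delta_vec n)) f.
Proof.
move=> x; under [X in series X]funext do rewrite mulrC.
apply: (dual_series_cvg (a := fun k => fine (mnorm M r%:E (lpM_seq x - trunc k x)))).
  by move=> k; rewrite norm_sub_sum_delta_vec.
exact: mnorm_sub_trunc_cvg0 Md r0 (lpM_mem x).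
Qed.

(** The converse of Hölder's inequality for [M] and [tr_infmx N], whose diagonals are reciprocal. *)
Lemma dual_lpM (N : nat -> nat -> cplx R) (q : \bar R) (f : dual V) :
  is_inverse M N -> (r%:E^-1 + q^-1 = 1)%E ->
  lpM (tr_infmx N) q (fun n => f (delta_vec n)).
Proof.
move=> MN pq; apply: (@dual_coef_lpM _ _ M _ r q delta_vec f) => [//||n|//|//|c k].
- exact: is_diagonal_tr (is_diagonal_inverse Md MN).
- exact: inverse_diag Md MN.
- by rewrite norm_sum_delta_vec.
Qed.

Lemma represents_sum (u : nat -> dual V) (c : nat -> cplx R) k :
  (forall n, represents (delta_seq n) (u n)) ->
  represents (trunc k c) (\sum_(0 <= n < k) c n *: u n).
Proof.
move=> ud; rewrite -sum_delta_seq.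
elim/big_rec2 : _ => [x|n f y _ yf]; last exact: represents_linear (ud n) yf.
rewrite [X in series X](_ : _ = cst 0).
  by apply: cvg_near_cst; apply: nearW => j; rewrite /series/= big1.
by apply/funext => n; rewrite mul0r.
Qed.

Lemma diagonal_reflexive (N : nat -> nat -> cplx R) (s : R) :
  is_inverse M N -> 1 <= s -> (r%:E^-1 + s%:E^-1 = 1)%E -> reflexive_space V.
Proof.
move=> MN s1 pq; have s0 : 0 < s by exact: lt_le_trans s1.
have trNd := is_diagonal_tr (is_diagonal_inverse Md MN).
have repr y : lpM (tr_infmx N) s%:E y -> exists f : dual V, represents y f.
  exact: (represents_exists p1 pq invM MN.2).
(* The [u n] are the coordinate functionals. *)
have /choice[u ud] n : exists f : dual V, represents (delta_seq n) f.
  by apply: repr; exact: lpM_delta_seq.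
have bnd y (f : dual V) : represents y f -> lpM (tr_infmx N) s%:E y ->
    `|f| <= (fine (mnorm (tr_infmx N) s%:E y))%:C%C.
  exact: (represents_norm pq MN.2).
apply/seteqP; split=> // phi _.
(* A preimage of [phi] must have the coordinates [phi (u n)]. They lie in l^p_M by the converse of
   Hölder's inequality with matrices and exponents exchanged. *)
have xr : lpM M r%:E (fun n => phi (u n)).
  apply: (@dual_coef_lpM _ _ (tr_infmx N) M s r%:E u phi) => [//|//|n|//||c k].
  - by rewrite mulrC; exact: inverse_diag Md MN.
  - by rewrite addeC.
  - by apply: bnd; [exact: represents_sum|exact: lpM_trunc].
exists (LpMSpace p1 invM (mem_set xr)) => //; apply: val_inj; apply/funext => f /=.
pose y n := f (delta_vec n).
have yf : represents y f by exact: dual_represented.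
have ys : lpM (tr_infmx N) s%:E y by exact: dual_lpM.
(* Both values are limits of one series: on the side of [phi], the truncations of [y] represent
   functionals tending to [f] in the dual norm, because [s] is finite. *)
apply: (cvg_unique (@norm_hausdorff _ _) (yf _)) => /=.
apply: (dual_series_cvg
  (a := fun k => fine (mnorm (tr_infmx N) s%:E (y - trunc k y)))) => [k|].
  apply: bnd.
  - exact: (representsB yf (represents_sum (c := y) (k := k) ud)).
  - by apply: lpMB => //; exact: lpM_trunc.
exact: mnorm_sub_trunc_cvg0.
Qed.

End diagonal_dual.

(** [N] ranges over all inverses of [M]. The reverse inclusion is restricted to [p < +oo] since it
    fails for bounded sequences: with the identity matrix, a Banach limit is represented by no
    sequence. *)
Theorem theorem4p1 (R : realType) (p q : \bar R)
    (p1 : (1 <= p)%E) (pq : (p^-1 + q^-1 = 1)%E)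
    (M N : nat -> nat -> cplx R) (invM : invertible M) (MN : is_inverse M N) :
  (forall y : nat -> cplx R, lpM (tr_infmx N) q y ->
     exists f : dual (lpM_space p1 invM), represents y f)
  /\
  ((p < +oo)%E -> is_diagonal M ->
     (forall f : dual (lpM_space p1 invM),
        exists y : nat -> cplx R, lpM (tr_infmx N) q y /\ represents y f)
     /\
     ((1 < p)%E -> reflexive_space (lpM_space p1 invM))).
Proof.
split; first by move=> y; exact: (represents_exists p1 pq invM MN.2).
case: p => [r| |]// in p1 pq * => _ Md.
split=> [f|r_gt1].
  by exists (fun n => f (delta_vec p1 invM Md n)); split;
    [exact: dual_lpM|exact: dual_represented].
(* [q = +oo] would force [r = 1]; a finite [q] gives density of finite sequences on the dual
   side. *)
have := conjugate_ge1 p1 pq; case: q pq => [s| |]// pq s1; last first.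
  move: pq; rewrite invey adde0 => /eqP; rewrite inve_eq1 => /eqP rE.
  by rewrite rE ltxx in r_gt1.
by apply: (diagonal_reflexive p1 invM Md MN _ pq); rewrite -lee_fin.
Qed.
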